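(* Let $d\ge 1$ be an integer. For each $1\le j\le d$ let $p_j\ge 3$ and let $m_1^j<m_2^j<\cdots<m_{p_j}^j$ be equally spaced real nodes, i.e. there is $c_j>0$ with $m_{i+1}^j-m_i^j=c_j$ for all $1\le i<p_j$. Let $\Omega=[m_1^1,m_{p_1}^1]\times\cdots\times[m_1^d,m_{p_d}^d]$. Let $\eta_1,\dots,\eta_d\in \mathrm{M}$ be arbitrary (not necessarily distinct), where $\mathrm{M}$ is the set of all normalized membership functions of one-dimensional strong-uniform fuzzy partitions, and define $\mu:\mathbb{R}^d\to\mathbb{R}$ by $$\mu(\mathbf{x})=\prod_{j=1}^{d}\eta_j\left(\frac{x_j}{c_j}\right).$$ For each multi-index $(i_1^A,\dots,i_d^A)$ with $1\le i_j^A\le p_j$, put $\mathbf{x}^A=[m_{i_1^A}^1,\dots,m_{i_d^A}^d]^T$ and let $A$ be the fuzzy subset of $\Omega$ with core $\mathbf{x}^A$ and membership function $\mu_A(\mathbf{x})=\mu(\mathbf{x}-\mathbf{x}^A)$. Then the family of these $\prod_{j=1}^d p_j$ fuzzy sets $\{A\}$ is a ($d$-dimensional) strong-uniform fuzzy partition of $\Omega$, with centralized membership function $\mu$.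
   Context: **One-dimensional strong-uniform fuzzy partition.** Let $\Omega=[a,b]$, $p\ge 3$, and let $a=m_1<m_2<\cdots<m_p=b$ be nodes, with the convention $m_0=m_1$ and $m_{p+1}=m_p$. Fuzzy subsets $A_1,\dots,A_p$ of $\Omega$, identified with their membership functions $\mu_{A_k}:\Omega\to[0,1]$, form a strong-uniform fuzzy partition of $\Omega$ if for $k=1,\dots,p$: 1. $\mu_{A_k}(m_k)=1$; 2. $\mu_{A_k}(x)=0$ if $x\notin[m_{k-1},m_{k+1}]$; 3. $\mu_{A_k}$ is continuous; 4. $\mu_{A_k}$ is monotonically increasing (non-decreasing) on $[m_{k-1},m_k]$ and monotonically decreasing (non-increasing) on $[m_k,m_{k+1}]$; 5. for every $x\in\Omega$ there is $k$ with $\mu_{A_k}(x)>0$; 6. $\sum_{k=1}^p\mu_{A_k}(x)=1$ for every $x\in\Omega$; 7. $m_{k+1}-m_k=h$ is constant for all $k\ne p$, so $m_k=a+(k-1)h$; 8. for $k\neq 1$, $k\ne p$ and all $x\in[0,h]$: $\mu_{A_k}(m_k-x)=\mu_{A_k}(m_k+x)$; 9. for $k\ne 1$, $k\neq p$ and all $x\in[m_k,m_{k+1}]$: $\mu_{A_k}(x)=\mu_{A_{k-1}}(x-h)$ and $\mu_{A_{k+1}}(x)=\mu_{A_k}(x-h)$. The centralized membership function of such a partition is the function $\mu:\mathbb{R}\to\mathbb{R}$ giving the common shape of the membership functions translated to the origin: $\mu(x)=\mu_{A_k}(m_k+x)$ for $|x|\le h$ (for any $k$ with $1<k<p$; by 8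 and 9 this does not depend on $k$), and $\mu(x)=0$ for $|x|>h$. Thus $\mu_{A_k}(x)=\mu(x-m_k)$ for all $k$ and $x\in\Omega$. **Normalized membership function.** For a one-dimensional strong-uniform fuzzy partition with node spacing $c$ (that is, $m_{i+1}-m_i=c$ for all $i<p$) and centralized membership function $\mu$, the normalized membership function is $\eta:\mathbb{R}\to\mathbb{R}$, $\eta(x)=\mu(cx)$. $\mathrm{M}$ denotes the set of all functions $\eta$ arising in this way, from all one-dimensional strong-uniform fuzzy partitions. **High-dimensional strong-uniform fuzzy partition.** Let $d$, the nodes $m_i^j$, the spacings $c_j$, the numbers $p_j\ge3$ and $\Omega=[m_1^1,m_{p_1}^1]\times\cdots\times[m_1^d,m_{p_d}^d]$ be as in the claim. A family of $\prod_{j=1}^d p_j$ fuzzy subsets $\{A\}$ of $\Omega$, one for each grid point $\mathbf{x}^A=[m_{i_1^A}^1,\dots,m_{i_d^A}^d]^T$ ($1\le i_j^A\le p_j$), called the core of $A$, with membership functions $\mu_A$, forms a strong-uniform fuzzy partition of $\Omega$ with centralized membership function $\mu:\mathbb{R}^d\to\mathbb{R}$ if: 1. $\mu$ is non-negative and continuous; 2. (translational symmetry) $\mu_A(\mathbf{x})=\mu(\mathbf{x}-\mathbf{x}^A)$ for every $A$; 3. (mirror symmetry in each dimension) if $|x_i|=|y_i|$ for all $i\le d$, then $\mu(\mathbf{x})=\mu(\mathbf{y})$; 4. $\mu(\mathbf{0})=1$; 5. for $\mathbf{x}\in\mathbb{R}^d$, if there is $1\le j\le d$ with $|x_j|>c_j$,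 then $\mu(\mathbf{x})=0$; 6. (strong-uniformity) $\sum_A\mu_A(\mathbf{x})=1$ for every $\mathbf{x}\in\Omega$; 7. (radial monotonicity) $\mu[(1+\varepsilon)\mathbf{x}]\le\mu(\mathbf{x})$ for all $\mathbf{x}\in\mathbb{R}^d$ and all $\varepsilon>0$. *)

(* Defs.v *)
From HB Require Import structures.
From mathcomp Require Import all_boot all_order all_algebra.
From mathcomp Require Import all_classical all_reals all_analysis.

Set Implicit Arguments.
Unset Strict Implicit.
Unset Printing Implicit Defensive.

Import Order.TTheory GRing.Theory Num.Theory.
Import numFieldNormedType.Exports.

Local Open Scope classical_set_scope.
Local Open Scope ring_scope.

(* Fuzzy subsets are given by total functions on the
   ambient space, of which only the restriction to Omega is meaningful: no
   definition below constrains or uses their values outside Omega. *)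

Definition fuzzy_subset (R : realType) (T : Type) (Omega : set T)
  (f : T -> R) : Prop :=
  forall x, Omega x -> 0 <= f x <= 1.

(* Nodes and membership functions are numbered from 1 to p, as m 1, ..., m p
   and A 1, ..., A p; m 0 and m p.+1 only encode the convention
   that the nodes repeat at both ends. *)
Record strong_uniform_partition1 (R : realType) (a b : R) (p : nat)
  (m : nat -> R) (h : R) (A : nat -> R -> R) : Prop :=
  StrongUniformPartition1 {
    sup1_size : (3 <= p)%N ;
    sup1_first : m 1%N = a ;
    sup1_last : m p = b ;
    sup1_nodes_lt : forall k, (1 <= k < p)%N -> m k < m k.+1 ;
    sup1_before : m 0%N = m 1%N ;
    sup1_after : m p.+1 = m p ;
    sup1_fuzzy : forall k, (1 <= k <= p)%N -> fuzzy_subset `[a, b] (A k) ;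
    sup1_core : forall k, (1 <= k <= p)%N -> A k (m k) = 1 ;
    sup1_support : forall k x, (1 <= k <= p)%N -> x \in `[a, b] ->
      x \notin `[m k.-1, m k.+1] -> A k x = 0 ;
    sup1_continuous : forall k, (1 <= k <= p)%N ->
      {within `[a, b], continuous (A k)} ;
    sup1_increasing : forall k, (1 <= k <= p)%N ->
      {in `[m k.-1, m k] &, {homo A k : x y / x <= y}} ;
    sup1_decreasing : forall k, (1 <= k <= p)%N ->
      {in `[m k, m k.+1] &, {homo A k : x y /~ x <= y}} ;
    sup1_cover : forall x, x \in `[a, b] ->
      exists2 k, (1 <= k <= p)%N & 0 < A k x ;
    sup1_sum : forall x, x \in `[a, b] -> \sum_(1 <= k < p.+1) A k x = 1 ;
    sup1_spacing : forall k, (1 <= k < p)%N -> m k.+1 - m k = h ;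
    sup1_mirror : forall k (x : R), (1 < k < p)%N -> x \in `[0, h] ->
      A k (m k - x) = A k (m k + x) ;
    sup1_translation : forall k x, (1 < k < p)%N -> x \in `[m k, m k.+1] ->
      A k x = A k.-1 (x - h) /\ A k.+1 x = A k (x - h)
  }.

(* The shape of the k-th membership function translated to the origin; it is
   meant for interior indices 1 < k < p, on which it does not depend (see
   centralized_mf_indep). *)
Definition centralized_mf (R : realType) (m : nat -> R) (h : R)
  (A : nat -> R -> R) (k : nat) (x : R) : R :=
  if `|x| <= h then A k (m k + x) else 0.

Lemma centralized_mf_indep (R : realType) (a b : R) (p : nat)
  (m : nat -> R) (h : R) (A : nat -> R -> R) (k l : nat) :
  strong_uniform_partition1 a b p m h A ->
  (1 < k < p)%N -> (1 < l < p)%N ->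
  centralized_mf m h A k = centralized_mf m h A l.
Proof.
move=> S.
have step i : (1 < i)%N -> (i.+1 < p)%N ->
    centralized_mf m h A i.+1 = centralized_mf m h A i.
  move=> i1 ip; apply/funext => x; rewrite /centralized_mf.
  case: ifP => // /[!ler_norml] /andP[xl xr].
  have i0 : (0 < i)%N by exact: ltnW.
  have mi1 : m i.+1 = m i + h.
    have := sup1_spacing S (k := i); rewrite i0 (ltnW ip) => /(_ isT) <-.
    by rewrite addrC subrK.
  have mi2 : m i.+2 = m i.+1 + h.
    have := sup1_spacing S (k := i.+1); rewrite ip => /(_ isT) <-.
    by rewrite addrC subrK.
  have e : m i.+1 + x - h = m i + x by rewrite mi1 addrAC addrK.
  have [x0|x0] := leP 0 x.
    have [] := @sup1_translation _ _ _ _ _ _ _ S i.+1 (m i.+1 + x).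
    - by rewrite ip ltnS i0.
    - by rewrite in_itv /= mi2 lerDl x0 lerD2l xr.
    by rewrite /= e.
  have [] := @sup1_translation _ _ _ _ _ _ _ S i (m i.+1 + x).
  - by rewrite i1 ltnW.
  - by rewrite in_itv /= gerDl (ltW x0) andbT mi1 -addrA lerDl -lerBlDl sub0r.
  by rewrite e.
have to2 i : (1 < i < p)%N -> centralized_mf m h A i = centralized_mf m h A 2%N.
  elim: i => [//|[//|[//|i]] IH] /andP[_ ip].
  by rewrite step // IH //= ltnW.
by move=> /to2 -> /to2 ->.
Qed.

Definition normalized_mf (R : realType) : set (R -> R) :=
  [set eta | exists (a b : R) (p : nat) (m : nat -> R) (c : R)
     (A : nat -> R -> R) (k : nat),
     [/\ strong_uniform_partition1 a b p m c A, (1 < k < p)%N &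
         eta = fun x => centralized_mf m c A k (c * x)]].

Section HighDimension.
Variables (R : realType) (d : nat) (p : 'I_d -> nat) (m : 'I_d -> nat -> R).

Definition grid_index := {dffun forall j : 'I_d, 'I_(p j)}.

Definition box : set 'rV[R]_d :=
  [set x | forall j, m j 1%N <= x ord0 j <= m j (p j)].

(* The nodes in direction j are m j 1, ..., m j (p j), whereas an ordinal
   starts at 0. *)
Definition grid_point (i : grid_index) : 'rV[R]_d := \row_j m j (i j).+1.

Record strong_uniform_partition (c : 'I_d -> R)
  (muA : grid_index -> 'rV[R]_d -> R) (mu : 'rV[R]_d -> R) : Prop :=
  StrongUniformPartition {
    sup_fuzzy : forall i, fuzzy_subset box (muA i) ;
    sup_ge0 : forall x, 0 <= mu x ;
    sup_continuous : continuous mu ;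
    sup_translation : forall i x, box x -> muA i x = mu (x - grid_point i) ;
    sup_mirror : forall x y : 'rV[R]_d,
      (forall j, `|x ord0 j| = `|y ord0 j|) -> mu x = mu y ;
    sup_core : mu 0 = 1 ;
    sup_support : forall x : 'rV[R]_d,
      (exists j, c j < `|x ord0 j|) -> mu x = 0 ;
    sup_sum : forall x, box x -> \sum_(i : grid_index) muA i x = 1 ;
    sup_radial : forall (x : 'rV[R]_d) (e : R), 0 < e ->
      mu ((1 + e) *: x) <= mu x
  }.

End HighDimension.

(* Main.v *)
Require Import Defs.
From HB Require Import structures.
From mathcomp Require Import all_boot all_order all_algebra.
From mathcomp Require Import all_classical all_reals all_analysis.
From mathcomp Require Import lra.

Set Implicit Arguments.
Unset Strict Implicit.
Unset Printing Implicit Defensive.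

Import Order.TTheory GRing.Theory Num.Theory.
Import numFieldNormedType.Exports.

Local Open Scope classical_set_scope.
Local Open Scope ring_scope.

(** On [m_k, m_k+1] only A_k and A_k+1 are nonzero and A_k+1 is the translate of
    A_k, so a normalized membership function f satisfies f x + f (x - 1) = 1 on
    [0, 1]; as f is supported in [-1, 1], its integer translates sum to 1 along
    any equally spaced nodes. The sum over the grid of the products is the
    product of these one-dimensional sums, by distributivity. Since f is even
    and nonincreasing on the nonnegative reals, the product inherits mirror
    symmetry and radial monotonicity factor by factor. *)

(** Dependent finite functions correspond to functions into the tagged union of the [T i] whose
    value at each [i] has tag [i]; this reduces the claim to distributivity over a fixed codomain.
    It serves grid indices, whose range ['I_(p j)] varies with [j]. *)
Lemma bigA_distr_dffun (R : comPzSemiRingType) (I : finType) (T : I -> finType)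
    (F : forall i, T i -> R) :
  \prod_i \sum_(j : T i) F i j =
  \sum_(f : {dffun forall i, T i}) \prod_i F i (f i).
Proof.
rewrite (reindex (@dffun_of_fprod I T)); last first.
  exact/onW_bij/dffun_of_fprod_bij.
under [RHS]eq_bigr do under eq_bigr do rewrite ffunE -[F _ _](ffunE (F _)).
rewrite (big_fprod 1 +%R (fun i => finfun (F i))).
rewrite -(bigA_distr_big_dep _ (fun i => untag 0 (finfun (F i)))).
apply: eq_bigr => i _; rewrite -(big_tag (fun i => finfun (F i))).
by apply: eq_bigr => j _; rewrite ffunE.
Qed.

(** * Equally spaced nodes *)

Section EquallySpaced.
Variables (R : realType) (p : nat) (m : nat -> R) (h : R).
Hypothesis spacing : forall i, (1 <= i < p)%N -> m i.+1 - m i = h.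

Lemma equally_spacedE i : (i < p)%N -> m i.+1 = m 1%N + i%:R * h.
Proof.
elim: i => [|i IH] ip; first by rewrite mul0r addr0.
by rewrite -(subrK (m i.+1) (m i.+2)) spacing // IH 1?ltnW// -natr1 mulrDl mul1r
  addrC addrA.
Qed.

Lemma equally_spaced_le i j : 0 <= h -> (0 < i <= j)%N -> (j <= p)%N ->
  m i <= m j.
Proof.
case: i j => [//|i] [//|j] h0 /= ij jp.
rewrite (equally_spacedE (leq_trans ij jp)) (equally_spacedE jp).
by rewrite lerD2l ler_wpM2r// ler_nat.
Qed.

End EquallySpaced.

(** * Profiles of spacing 1 and sums of their translates *)

(** What the product construction uses of each factor, freed from the underlying partition. The
    support condition includes [|x| = 1], so at an integer point exactly one integer translate
    survives. *)
Record unit_profile (R : realType) (f : R -> R) : Prop := UnitProfile {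
  profile_ge0 : forall x, 0 <= f x ;
  profile_core : f 0 = 1 ;
  profile_support : forall x, 1 <= `|x| -> f x = 0 ;
  profile_even : forall x, f (- x) = f x ;
  profile_nonincreasing : forall x y, 0 <= x -> x <= y -> f y <= f x ;
  profile_unity : forall x, 0 <= x <= 1 -> f x + f (x - 1) = 1 ;
  profile_continuous : continuous f
}.

Section UnitProfile.
Variables (R : realType) (f : R -> R).
Hypothesis fP : unit_profile f.

Lemma profile_norm x : f `|x| = f x.
Proof. by case: (ger0P x) => _ //; rewrite (profile_even fP). Qed.

Lemma profile_le1 x : f x <= 1.
Proof.
by rewrite -profile_norm -(profile_core fP); apply: profile_nonincreasing.
Qed.

Lemma profile_radial e x : 0 < e -> f ((1 + e) * x) <= f x.
Proof.
move=> e0; rewrite -[leLHS]profile_norm -[leRHS]profile_norm.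
apply: profile_nonincreasing => //.
by rewrite normrM ler_peMl// gtr0_norm ?addr_gt0// lerDl ltW.
Qed.

Lemma profile_sum n y : 0 <= y <= n%:R -> \sum_(i < n.+1) f (y - i%:R) = 1.
Proof.
elim: n y => [|n IH] y /andP[y0 yn].
  by rewrite big_ord1 subr0 (@le_anti _ _ y 0) ?y0 ?yn// (profile_core fP).
rewrite big_ord_recl subr0.
have shift (i : 'I_n.+1) : f (y - (bump 0 i)%:R) = f (y - 1 - i%:R).
  by rewrite /bump /= natrD opprD addrA.
under eq_bigr do rewrite shift.
(* For [1 <= y] the translate at 0 vanishes and the rest is the sum for [y - 1]; for [y < 1] only
   the translates at 0 and 1 survive. *)
have [y1|y1] := leP 1 y.
  rewrite (profile_support fP) ?ger0_norm// add0r IH//.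
  by rewrite subr_ge0 y1 lerBlDr natr1.
rewrite big_ord_recl subr0 big1 ?addr0; last first.
  move=> i _; rewrite (profile_support fP)// ler0_norm; last first.
    by rewrite /= /bump /= natrD; have := ler0n R i; lra.
  by rewrite /= /bump /= natrD; have := ler0n R i; lra.
by rewrite (profile_unity fP)// y0 ltW.
Qed.

(** In the coordinate [(x - m 1) / h] the nodes become the integers from 0 to [p - 1]. *)
Lemma profile_sum_nodes p m h x :
  (0 < p)%N -> 0 < h -> (forall i, (1 <= i < p)%N -> m i.+1 - m i = h) ->
  m 1%N <= x <= m p -> \sum_(i < p) f ((x - m i.+1) / h) = 1.
Proof.
case: p => [//|p] _ h0 hm /andP[xl xr].
rewrite -(@profile_sum p ((x - m 1%N) / h)).
  apply: eq_bigr => i _; rewrite (equally_spacedE hm)//.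
  by rewrite opprD addrA mulrBl mulfK// gt_eqF.
rewrite divr_ge0 ?subr_ge0 ?(ltW h0)//= ler_pdivrMr// lerBlDl.
by rewrite -(equally_spacedE hm).
Qed.

End UnitProfile.

(** * One-dimensional partitions near their nodes *)

Section Partition1.
Variables (R : realType) (a b : R) (p : nat) (m : nat -> R) (h : R).
Variables (A : nat -> R -> R).
Hypothesis S : strong_uniform_partition1 a b p m h A.

Lemma sup1_spacing_gt0 : 0 < h.
Proof.
have p1 : (1 <= 1 < p)%N by rewrite /= ltnW// (sup1_size S).
by rewrite -(sup1_spacing S p1) subr_gt0 (sup1_nodes_lt S).
Qed.

Lemma sup1_node_le i j : (0 < i <= j)%N -> (j <= p)%N -> m i <= m j.
Proof. exact/(equally_spaced_le (sup1_spacing S))/ltW/sup1_spacing_gt0. Qed.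

Lemma sup1_node_in k : (1 <= k <= p)%N -> m k \in `[a, b].
Proof.
move=> /andP[k1 kp].
by rewrite in_itv /= -(sup1_first S) -(sup1_last S) !sup1_node_le// ?k1 ?kp.
Qed.

Lemma sup1_ge0 k x : (1 <= k <= p)%N -> x \in `[a, b] -> 0 <= A k x.
Proof. by move=> kp /(sup1_fuzzy S kp)/andP[]. Qed.

Lemma sup1_sum_pair i j x : (1 <= i <= p)%N -> (1 <= j <= p)%N -> i != j ->
  x \in `[a, b] ->
  A i x + A j x +
    \sum_(1 <= k < p.+1 | (k != i) && (k != j)) A k x = 1.
Proof.
move=> ip jp ij xab.
rewrite -(sup1_sum S xab) [RHS](bigD1_seq i) ?iota_uniq ?mem_index_iota//=.
rewrite -[in RHS]big_filter [in RHS](bigD1_seq j) ?filter_uniq ?iota_uniq//=.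
  by rewrite big_filter_cond addrA.
by rewrite mem_filter mem_index_iota eq_sym ij.
Qed.

(** At [m j] the term [A j] already exhausts the sum 1, and all terms are nonnegative. For adjacent
    nodes the support condition does not give this, as it is silent at the ends of
    [[m k.-1, m k.+1]]. *)
Lemma sup1_other_node i j : (1 <= i <= p)%N -> (1 <= j <= p)%N -> i != j ->
  A i (m j) = 0.
Proof.
move=> ip jp ij; have mab := sup1_node_in jp.
have := sup1_sum_pair ip jp ij mab; rewrite (sup1_core S)//.
have := sup1_ge0 ip mab.
set s := \sum_(_ <= _ < _ | _) _ => A0.
have : 0 <= s.
  rewrite /s big_nat_cond; apply: sumr_ge0 => k /andP[kp _].
  exact: sup1_ge0.
lra.
Qed.

Lemma sup1_neighbours k x : (1 <= k < p)%N -> m k < x < m k.+1 ->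
  A k x + A k.+1 x = 1.
Proof.
move=> /andP[k1 kp] /andP[xl xr].
have xab : x \in `[a, b].
  have := sup1_node_in (k := k); have := sup1_node_in (k := k.+1).
  rewrite k1 kp (ltnW kp) !in_itv /= => /(_ isT)/andP[_ u] /(_ isT)/andP[l _].
  by rewrite (le_trans l (ltW xl)) (le_trans (ltW xr) u).
have := @sup1_sum_pair k k.+1 x.
rewrite k1 kp (ltnW kp) ltn_eqF// => /(_ isT isT isT xab).
rewrite big_nat_cond big1 ?addr0// => i /andP[/andP[i1 ip] /andP[ik ik1]].
apply: (sup1_support S) => //; first by rewrite i1.
(* If [i < k] then [m i.+1 <= m k < x]; otherwise [k.+1 < i] and [x < m k.+1 <= m i.-1]. *)
rewrite in_itv /= negb_and -!ltNge; have [ilt|] := ltnP i k.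
  by rewrite (le_lt_trans _ xl) ?orbT// sup1_node_le// ltnW.
rewrite leq_eqVlt eq_sym (negbTE ik)/= leq_eqVlt eq_sym (negbTE ik1)/= => ilt.
case: i ilt i1 ip {ik ik1} => //= i ilt i1 ip.
by rewrite (lt_le_trans xr) // sup1_node_le// ltnW.
Qed.

(** * The centralized membership function *)

Section Centralized.
Variable k : nat.
Hypothesis kp : (1 < k < p)%N.
Notation mu := (centralized_mf m h A k).

Let k1p : (1 <= k <= p)%N.
Proof. by case/andP: kp => k1 kq; rewrite !(ltnW k1, ltnW kq). Qed.

Let kSp : (1 <= k.+1 <= p)%N.
Proof. by case/andP: kp. Qed.

Let kPp : (1 <= k.-1 <= p)%N.
Proof.
case/andP: kp => k1 /ltnW kq; rewrite (leq_trans (leq_pred k) kq) andbT.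
by rewrite -ltnS prednK// ltnW.
Qed.

Let mS : m k.+1 = m k + h.
Proof.
rewrite -(sup1_spacing S (k := k)) 1?addrC ?subrK//.
by case/andP: kp => /ltnW ->.
Qed.

Let mP : m k.-1 = m k - h.
Proof.
have [k1 kq] := andP kp; have [kP0 _] := andP kPp.
have := sup1_spacing S (k := k.-1); rewrite prednK ?(ltnW k1)// => <-.
  by rewrite subKr.
by rewrite kP0 ltnW.
Qed.

Let window y : `|y| <= h -> m k + y \in `[a, b].
Proof.
rewrite ler_norml => /andP[yl yr].
have := sup1_node_in kSp; have := sup1_node_in kPp.
by rewrite mS mP !in_itv /= => /andP[l _] /andP[_ u]; apply/andP; split; lra.
Qed.

Lemma centralized_ge0 x : 0 <= mu x.
Proof.
by rewrite /centralized_mf; case: ifP => // /window; exact: sup1_ge0.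
Qed.

Lemma centralized_core : mu 0 = 1.
Proof.
by rewrite /centralized_mf normr0 (ltW sup1_spacing_gt0) addr0 (sup1_core S).
Qed.

Lemma centralized_support x : h <= `|x| -> mu x = 0.
Proof.
move=> hx; rewrite /centralized_mf; case: ifP => // xh.
(* Only [|x| = h] remains, where [m k + x] is a neighbouring node. *)
have {hx xh} : `|x| = h by apply/le_anti; rewrite hx xh.
have h0 := sup1_spacing_gt0.
case: (ger0P x) => _ => [->|xh].
  by rewrite -mS sup1_other_node// ltn_eqF.
have -> : m k + x = m k.-1 by rewrite mP -xh opprK.
by rewrite sup1_other_node// gtn_eqF// ltn_predL; case/andP: k1p.
Qed.

Lemma centralized_even x : mu (- x) = mu x.
Proof.
wlog x0 : x / 0 <= x => [wl|].
  have [/wl//|/ltW x0] := leP 0 x.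
  by rewrite -[in RHS](opprK x) [RHS]wl// oppr_ge0.
rewrite /centralized_mf normrN; case: ifP => //.
by rewrite ger0_norm// => xh; rewrite (sup1_mirror S)// in_itv /= x0.
Qed.

Lemma centralized_nonincreasing x y : 0 <= x -> x <= y -> mu y <= mu x.
Proof.
move=> x0 xy; have y0 := le_trans x0 xy.
have [yh|yh] := leP y h; last first.
  by rewrite [leLHS]centralized_support ?centralized_ge0// ger0_norm// ltW.
rewrite /centralized_mf !ger0_norm// yh (le_trans xy yh).
apply: (sup1_decreasing S) => //; rewrite ?lerD2l//.
  by rewrite in_itv /= mS lerDl lerD2l y0.
by rewrite in_itv /= mS lerDl lerD2l x0 (le_trans xy).
Qed.

(** Translation turns [A k (m k + x - h)] into [A k.+1 (m k + x)], so strictly between nodes this is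
    [sup1_neighbours]. At each end one term is the core value and the other vanishes. *)
Lemma centralized_unity x : 0 <= x <= h -> mu x + mu (x - h) = 1.
Proof.
have h0 := sup1_spacing_gt0.
move=> /andP[]; rewrite le_eqVlt => /predU1P[<- _|x0].
  rewrite centralized_core sub0r centralized_support ?addr0//.
  by rewrite normrN gtr0_norm.
rewrite le_eqVlt => /predU1P[->|xh].
  by rewrite subrr centralized_core centralized_support ?add0r// gtr0_norm.
have x_h : `|x| <= h by rewrite gtr0_norm// ltW.
have xh_h : `|x - h| <= h by rewrite ler_norml; apply/andP; split; lra.
rewrite /centralized_mf x_h xh_h addrA.
have [] := @sup1_translation _ _ _ _ _ _ _ S k (m k + x) kp.
  by rewrite in_itv /= mS lerDl lerD2l !ltW.
move=> _ <-; apply: sup1_neighbours.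
  by case/andP: kp => /ltnW ->.
by rewrite mS ltrDl ltrD2l x0.
Qed.

(* mu vanishes at both ends of [-h, h], so it is A k precomposed with the
   continuous clamping of the line onto that interval. *)
Lemma centralized_continuous : continuous mu.
Proof.
have h0 := sup1_spacing_gt0.
pose clamp (x : R) : R := Num.max (- h) (Num.min h x).
have clampP x : `|clamp x| <= h.
  by rewrite ler_norml /clamp ge_max le_max lexx/= ge_min lexx/= andbT; lra.
have muE : mu = (fun y => A k (m k + y)) \o clamp.
  apply/funext => x /=; rewrite /centralized_mf /clamp.
  case: leP => [|hx].
    by rewrite ler_norml => /andP[xl xr]; rewrite (min_idPr xr) (max_idPr xl).
  have [x0|x0] := leP 0 x.
    rewrite ger0_norm// in hx; rewrite (min_idPl (ltW hx)).
    rewrite (max_idPr _); last by lra.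
    by rewrite -mS sup1_other_node// ltn_eqF.
  rewrite ltr0_norm// in hx.
  rewrite (min_idPr _); last by lra.
  rewrite (max_idPl _); last by lra.
  by rewrite -mP sup1_other_node// gtn_eqF// ltn_predL; case/andP: k1p.
have clamp_cont : continuous clamp.
  move=> x; apply: (@continuous_max _ _ (cst (- h)) (Num.min h)).
    exact: cvg_cst.
  by apply: (@continuous_min _ _ (cst h) id); [exact: cvg_cst|exact: cvg_id].
move=> x; rewrite muE /continuous_at.
(* Continuity of [A k] within [[a, b]] suffices, since [m k + clamp y] never leaves that
   interval. *)
have /subspace_continuousP/(_ (m k + clamp x)) Ac := sup1_continuous S k1p.
apply: cvg_trans (Ac (window (clampP x))).
move=> U /= AU.
have sc : (fun y => m k + clamp y) @ x --> m k + clamp x.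
  by apply: cvgD; [exact: cvg_cst|exact: clamp_cont].
by apply: (@filterS _ (nbhs x)) (sc _ AU) => y; apply; exact/window/clampP.
Qed.

End Centralized.
End Partition1.

(** * Normalization and the product partition *)

Lemma normalized_mf_profile (R : realType) (f : R -> R) :
  normalized_mf f -> unit_profile f.
Proof.
case=> [a [b [p [m [h [A [k [S kp ->]]]]]]]].
have h0 := sup1_spacing_gt0 S; have h_ge0 := ltW h0.
split => [x||x x1|x|x y x0 xy|x /andP[x0 x1]|x].
- exact: centralized_ge0 S _ kp _.
- by rewrite mulr0 (centralized_core S).
- by rewrite (centralized_support S)// normrM gtr0_norm// ler_peMr.
- by rewrite mulrN (centralized_even S).
- by apply: (centralized_nonincreasing S) => //; rewrite ?mulr_ge0// ler_wpM2l.
- rewrite mulrBr mulr1 (centralized_unity S)// mulr_ge0//=.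
  by rewrite ger_pMr.
- apply: (@continuous_comp _ _ _ ( *%R h) (centralized_mf m h A k)).
    exact: mulrl_continuous.
  exact: (centralized_continuous S).
Qed.

Theorem theorem2 (R : realType) (d : nat) (hd : (1 <= d)%N)
  (p : 'I_d -> nat) (m : 'I_d -> nat -> R) (c : 'I_d -> R)
  (hp : forall j, (3 <= p j)%N)
  (hm : forall j i, (1 <= i < p j)%N -> m j i < m j i.+1)
  (hc : forall j, 0 < c j)
  (hspacing : forall j i, (1 <= i < p j)%N -> m j i.+1 - m j i = c j)
  (eta : 'I_d -> R -> R) (heta : forall j, normalized_mf (eta j)) :
  let mu := fun x : 'rV[R]_d => \prod_(j < d) eta j (x ord0 j / c j) in
  let muA := fun (i : grid_index p) (x : 'rV[R]_d) =>
    mu (x - grid_point m i) in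
  strong_uniform_partition m c muA mu.
Proof.
move=> mu muA; have etaP j := normalized_mf_profile (heta j).
have mu_ge0 x : 0 <= mu x by apply: prodr_ge0 => j _; exact: profile_ge0.
split => //.
- move=> i x _; rewrite mu_ge0 /= /mu.
  by apply: prodr_ile1 => j _; rewrite profile_ge0// profile_le1.
- apply: continuous_big => [|j _ x]; first exact: mul_continuous.
  have cst_c := @cst_continuous 'rV[R]_d R (c j)^-1 x.
  have coord_c := continuousM (@coord_continuous R 1 d ord0 j x) cst_c.
  have eta_c : continuous (eta j) by case: (etaP j).
  exact: (continuous_comp coord_c (eta_c _)).
- move=> x y xy; apply: eq_bigr => j _.
  by rewrite -[LHS]profile_norm// -[RHS]profile_norm// !normrM xy.
- by rewrite /mu big1// => j _; rewrite mxE mul0r (profile_core (etaP j)).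
- move=> x [j cx]; rewrite /mu (bigD1 j)//= (profile_support (etaP j)) ?mul0r//.
  by rewrite normrM normfV (gtr0_norm (hc j)) ler_pdivlMr// mul1r ltW.
- move=> x xbox; rewrite /muA /mu.
  (* Coordinatewise, factor [j] of each summand depends on the grid index only through its [j]-th
     entry, as distributivity requires. *)
  under eq_bigr do under eq_bigr do rewrite !mxE.
  rewrite -(bigA_distr_dffun
    (fun j (i : 'I_(p j)) => eta j ((x ord0 j - m j i.+1) / c j))).
  apply: big1 => j _.
  apply: (profile_sum_nodes (etaP j) _ (hc j) (hspacing j) (xbox j)).
  exact: ltnW (ltnW (hp j)).
(* Nonnegativity of the factors lets the factorwise inequalities be multiplied. *)
- move=> x e e0; apply: ler_prod => j _.
  by rewrite profile_ge0//= mxE -mulrA profile_radial.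
Qed.
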